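(* Let $n,s\in\mathbb{N}_0$ and $P_n\in M_n$. Then for all $x\in\mathbb{R}^d$: if $s$ is even, $H_{s,\mu,P_n}(x)=2^s\,(\tfrac{s}{2})!\,L^{\frac{\mu}{2}+n-1}_{s/2}(|x|^2)\,P_n(x)$; if $s$ is odd, $H_{s,\mu,P_n}(x)=-2^s\,(\tfrac{s-1}{2})!\;x\,L^{\frac{\mu}{2}+n}_{(s-1)/2}(|x|^2)\,P_n(x)$, where $L^\alpha_m(y)=\sum_{j=0}^m\frac{\Gamma(m+\alpha+1)}{j!\,(m-j)!\,\Gamma(j+\alpha+1)}(-y)^j$ is the generalized Laguerre polynomial.
   Context: Let $d\ge 2$. $\mathbb{R}_{0,d}$ is the real Clifford algebra generated by $e_1,\dots,e_d$ with $e_ie_j+e_je_i=-2\delta_{ij}$; vectors $x$ are identified with $\sum_ix_ie_i$, so $x^2=-|x|^2$. $R$ is a root system with reflection group $W$, positive subsystem $R_+$, $\kappa:R\to[0,\infty)$ a $W$-invariant multiplicity function with $\gamma_\kappa=\sum_{\alpha\in R_+}\kappa(\alpha)>0$, $\mu=2\gamma_\kappa+d$. Dunkl operators $T_if(x)=\partial_{x_i}f(x)+\sum_{\alpha\in R_+}\kappa(\alpha)\frac{f(x)-f(\sigma_\alpha x)}{\langle\alpha,x\rangle}\alpha_i$; Dunkl–Dirac operator $D_h=\sum_ie_iT_i$. $M_n$: $\mathbb{C}\otimes\mathbb{R}_{0,d}$-valued homogeneous polynomials of degree $n$ with $D_hP=0$. $D_+f=D_hf-2xf$, and $H_{s,\mu,P_n}=(D_+)^sP_n$.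 *)

(* Defs.v *)
From Stdlib Require Import Reals List ClassicalEpsilon Factorial.
From mathcomp Require Import all_boot.
Set Implicit Arguments. Unset Strict Implicit. Unset Printing Implicit Defensive.

Local Open Scope R_scope.

Definition vecR (d : nat) := 'I_d -> R.
Definition inner d (x y : vecR d) : R := \big[Rplus/0]_(i < d) (x i * y i).
Definition norm2 d (x : vecR d) : R := inner x x.
Definition vzero d : vecR d := fun _ => 0.
Definition vscale d (c : R) (x : vecR d) : vecR d := fun i => c * x i.
Definition unitv d (i : 'I_d) : vecR d := fun j => if j == i then 1 else 0.
Definition refl d (a x : vecR d) : vecR d :=
  fun i => x i - 2 * inner a x / norm2 a * a i.

Definition Cx := (R * R)%type.
Definition C0 : Cx := (0, 0).
Definition Cadd (u v : Cx) : Cx := (u.1 + v.1, u.2 + v.2).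
Definition Cmul (u v : Cx) : Cx := (u.1 * v.1 - u.2 * v.2, u.1 * v.2 + u.2 * v.1).
Definition Cscale (r : R) (u : Cx) : Cx := (r * u.1, r * u.2).

(* ---------- complexified Clifford algebra C (x) R_{0,d} ----------
   An element is the family of its (complex) coefficients on the blade basis
   e_A = e_{a1} ... e_{ak} (a1 < ... < ak), A : {set 'I_d}. *)
Definition CCl (d : nat) := {set 'I_d} -> Cx.
Definition ccl0 d : CCl d := fun _ => C0.
Definition ccl_add d (u v : CCl d) : CCl d := fun A => Cadd (u A) (v A).
Definition ccl_scale d (r : R) (u : CCl d) : CCl d := fun A => Cscale r (u A).

Definition symd d (A B : {set 'I_d}) : {set 'I_d} := (A :\: B) :|: (B :\: A).
(* e_A e_B = cl_sign A B e_{A symdiff B}, using e_i e_j = - e_j e_i (i<>j), e_i^2 = -1 *)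
Definition cl_sign d (A B : {set 'I_d}) : R :=
  (-1) ^ (#|[set p : 'I_d * 'I_d | [&& p.1 \in A, p.2 \in B & (p.2 < p.1)%N]]|
          + #|A :&: B|)%N.
Definition clmul d (u v : CCl d) : CCl d := fun C =>
  \big[Cadd/C0]_(A : {set 'I_d}) Cscale (cl_sign A (symd A C)) (Cmul (u A) (v (symd A C))).
Definition vec d (x : vecR d) : CCl d := fun A =>
  (\big[Rplus/0]_(i < d) (if A == [set i] then x i else 0), 0).

Definition CFun (d : nat) := vecR d -> CCl d.
Definition upd d (x : vecR d) (i : 'I_d) (t : R) : vecR d :=
  fun j => if j == i then t else x j.
(* derivative of a real function at t (meaningful when it exists) *)
Definition deriv1 (g : R -> R) (t : R) : R :=
  epsilon (inhabits 0) (fun l => derivable_pt_lim g t l).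
Definition pderiv d (i : 'I_d) (f : CFun d) : CFun d := fun x A =>
  (deriv1 (fun t => (f (upd x i t) A).1) (x i),
   deriv1 (fun t => (f (upd x i t) A).2) (x i)).

Definition root_system d (RS : seq (vecR d)) : Prop :=
  NoDup RS /\
  (forall a, In a RS -> a <> @vzero d) /\
  (forall a b, In a RS -> In b RS -> In (refl a b) RS) /\
  (forall a c, In a RS -> In (vscale c a) RS -> c = 1 \/ c = -1).

Definition positive_subsystem d (RS Rp : seq (vecR d)) : Prop :=
  NoDup Rp /\
  exists b : vecR d,
    (forall a, In a RS -> inner a b <> 0) /\
    (forall a, In a Rp <-> (In a RS /\ 0 < inner a b)).

Definition in_W d (RS : seq (vecR d)) (w : vecR d -> vecR d) : Prop :=
  exists l : seq (vecR d), (forall a, In a l -> In a RS) /\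
    w = foldr (fun a g => fun x => refl a (g x)) id l.

Definition multiplicity d (RS : seq (vecR d)) (k : vecR d -> R) : Prop :=
  (forall a, In a RS -> 0 <= k a) /\
  (forall w a, in_W RS w -> In a RS -> k (w a) = k a).

Definition gamma_k d (Rp : seq (vecR d)) (k : vecR d -> R) : R :=
  \big[Rplus/0]_(a <- Rp) k a.
Definition mu_k d (Rp : seq (vecR d)) (k : vecR d -> R) : R :=
  2 * gamma_k Rp k + INR d.

(* ---------- Dunkl operators ----------
   (f(x) - f(sigma_a x)) / <a,x>, extended to the hyperplane <a,x> = 0 by its
   limit 2/|a|^2 * (a . grad f)(x) (continuous extension for C^1 f). *)
Definition dunkl_diff d (a : vecR d) (f : CFun d) (x : vecR d) : CCl d :=
  if Req_EM_T (inner a x) 0 then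
    ccl_scale (2 / norm2 a)
      (\big[@ccl_add d/@ccl0 d]_(j < d) ccl_scale (a j) (pderiv j f x))
  else ccl_scale (/ inner a x) (ccl_add (f x) (ccl_scale (-1) (f (refl a x)))).

Definition dunkl d (Rp : seq (vecR d)) (k : vecR d -> R) (i : 'I_d) (f : CFun d) : CFun d :=
  fun x => ccl_add (pderiv i f x)
    (\big[@ccl_add d/@ccl0 d]_(a <- Rp) ccl_scale (k a * a i) (dunkl_diff a f x)).

Definition dirac d (Rp : seq (vecR d)) (k : vecR d -> R) (f : CFun d) : CFun d :=
  fun x => \big[@ccl_add d/@ccl0 d]_(i < d) clmul (vec (unitv i)) (dunkl Rp k i f x).

Definition Dplus d (Rp : seq (vecR d)) (k : vecR d -> R) (f : CFun d) : CFun d :=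
  fun x => ccl_add (dirac Rp k f x) (ccl_scale (-2) (clmul (vec x) (f x))).

Definition Hsmu d (Rp : seq (vecR d)) (k : vecR d -> R) (s : nat) (P : CFun d) : CFun d :=
  iter s (Dplus Rp k) P.

Definition is_hom_poly d (n : nat) (P : CFun d) : Prop :=
  exists c : {ffun 'I_d -> 'I_n.+1} -> CCl d, forall x : vecR d,
    P x = \big[@ccl_add d/@ccl0 d]_(b : {ffun 'I_d -> 'I_n.+1} |
                                   (\sum_(i < d) (b i : nat))%N == n)
            ccl_scale (\big[Rmult/1]_(i < d) (x i ^ (b i : nat))) (c b).

Definition in_Mn d (Rp : seq (vecR d)) (k : vecR d -> R) (n : nat) (P : CFun d) : Prop :=
  is_hom_poly n P /\ forall x, dirac Rp k P x = @ccl0 d.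

(* ---------- Gamma function (Euler-Gauss limit) and Laguerre polynomials ---------- *)
Definition Gamma (z : R) : R :=
  epsilon (inhabits 0) (fun l => Un_cv (fun m : nat =>
     INR (fact m) * Rpower (INR m) z / \big[Rmult/1]_(j < m.+1) (z + INR j)) l).

Definition laguerre (al : R) (m : nat) (y : R) : R :=
  \big[Rplus/0]_(j < m.+1)
     (Gamma (INR m + al + 1)
        / (INR (fact j) * INR (fact (m - j)%N) * Gamma (INR j + al + 1))
        * (- y) ^ j).

(* Main.v *)
(** Write [a_m(x) = x^m P(x)] (Clifford powers of the vector variable).  The
    commutation rule [D_h(x f) = - x D_h f - (2 E + mu) f], with [E] the Euler
    operator, follows from the anticommutation of the [e_i], from the product
    rule of each [T_i] against a coordinate, and from
    [sum_i x_i T_i f = E f + sum_a k(a) (f - f o sigma_a)]: the reflected terms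
    cancel because [(sum_i a_i e_i)^2 = - |a|^2].  By induction
    [D_h a_(2j) = - 2j a_(2j-1)] and
    [D_h a_(2j+1) = - (2n + mu + 2j) a_(2j)], so [D_+] acts on the span of the
    [a_m] by explicit coefficients, and the claim reduces to two recurrences
    between the coefficients of [L^al_m] and [L^(al+1)_m], which come from
    [Gamma (z + 1) = z Gamma z].  The convergence of Gauss' limit, needed for
    [Gamma] to be meaningful, is monotone convergence on [0 < z <= 1] and is
    transported by the functional equation. *)
From HB Require Import structures.
Require Import Defs.
From Stdlib Require Import Reals List Factorial.
From Stdlib Require Import FunctionalExtensionality ClassicalEpsilon Lra.
From mathcomp Require Import all_boot.
Set Implicit Arguments. Unset Strict Implicit. Unset Printing Implicit Defensive.
Local Open Scope R_scope.

(** * The Clifford algebra in coordinates *)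

HB.instance Definition _ := Monoid.isComLaw.Build R 0 Rplus
  (fun x y z => esym (Rplus_assoc x y z)) Rplus_comm Rplus_0_l.
HB.instance Definition _ := Monoid.isComLaw.Build R 1 Rmult
  (fun x y z => esym (Rmult_assoc x y z)) Rmult_comm Rmult_1_l.
HB.instance Definition _ := Monoid.isMulLaw.Build R 0 Rmult Rmult_0_l Rmult_0_r.
HB.instance Definition _ := Monoid.isAddLaw.Build R Rmult Rplus
  Rmult_plus_distr_r Rmult_plus_distr_l.

(** Membership is [In] because [vecR d] carries no decidable equality. This brings the non-vanishing
    of the roots into sums over [Rp]. *)
Lemma eq_big_In (T I : Type) (op : T -> T -> T) (e : T) (s : seq I) (F G : I -> T) :
  (forall i, In i s -> F i = G i) ->
  \big[op/e]_(i <- s) F i = \big[op/e]_(i <- s) G i.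
Proof.
elim: s => [|a s IH] FG; first by rewrite !big_nil.
rewrite !big_cons FG; last by left.
by rewrite IH // => i si; apply: FG; right.
Qed.

Lemma inner_delta d (F : 'I_d -> R) (i : 'I_d) :
  \big[Rplus/0]_(j < d) (unitv i j * F j) = F i.
Proof.
rewrite (bigD1 i) //= big1 /unitv ?eqxx; first by ring.
by move=> j /negbTE ->; ring.
Qed.

Section Clifford.
Variable d : nat.
Implicit Types (u v : CCl d) (x y : vecR d) (A B : {set 'I_d}).

(** The real ([true]) or imaginary part of one blade coefficient; through [coord_ext] every Clifford
    identity becomes a family of real ones. *)
Definition coord (b : bool) A u : R := if b then (u A).1 else (u A).2.

Lemma coord_ext u v : (forall b A, coord b A u = coord b A v) -> u = v.
Proof.
move=> uv; apply: functional_extensionality => A.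
move: (uv true A) (uv false A); rewrite /coord.
by case: (u A) (v A) => [? ?] [? ?] /= -> ->.
Qed.

Lemma coord_add b A u v : coord b A (ccl_add u v) = coord b A u + coord b A v.
Proof. by case: b. Qed.

Lemma coord_scale b A r u : coord b A (ccl_scale r u) = r * coord b A u.
Proof. by case: b. Qed.

Lemma coord0 b A : coord b A (@ccl0 d) = 0.
Proof. by case: b. Qed.

Lemma coord_sum b A (I : Type) (s : seq I) (p : pred I) (F : I -> CCl d) :
  coord b A (\big[@ccl_add d/@ccl0 d]_(i <- s | p i) F i) =
  \big[Rplus/0]_(i <- s | p i) coord b A (F i).
Proof. exact: (big_morph _ (coord_add b A) (coord0 b A)). Qed.

Definition coordE := (coord_add, coord_scale, coord0, coord_sum).

Lemma ccl_addA : associative (@ccl_add d).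
Proof. by move=> u v w; apply: coord_ext => b A; rewrite !coordE; ring. Qed.
Lemma ccl_addC : commutative (@ccl_add d).
Proof. by move=> u v; apply: coord_ext => b A; rewrite !coordE; ring. Qed.
Lemma ccl_add0 : left_id (@ccl0 d) (@ccl_add d).
Proof. by move=> u; apply: coord_ext => b A; rewrite !coordE; ring. Qed.

HB.instance Definition _ :=
  Monoid.isComLaw.Build (CCl d) (@ccl0 d) (@ccl_add d) ccl_addA ccl_addC ccl_add0.

(** The sign in [e_i e_B = +- e_A], where [B] is [A] with [i] toggled. *)
Definition blade_sign (i : 'I_d) A : R := cl_sign [set i] (symd [set i] A).

Lemma Cx_sum1 (I : Type) (s : seq I) (F : I -> Cx) :
  (\big[Cadd/C0]_(i <- s) F i).1 = \big[Rplus/0]_(i <- s) (F i).1.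
Proof. exact: (big_morph fst (id1 := 0) (op1 := Rplus)). Qed.
Lemma Cx_sum2 (I : Type) (s : seq I) (F : I -> Cx) :
  (\big[Cadd/C0]_(i <- s) F i).2 = \big[Rplus/0]_(i <- s) (F i).2.
Proof. exact: (big_morph snd (id1 := 0) (op1 := Rplus)). Qed.

(** [vec y] is real and supported on singletons, so only [d] terms of the sum over all blades
    survive. *)
Lemma coord_clmul_vec b A y u :
  coord b A (clmul (vec y) u) =
  \big[Rplus/0]_(i < d) (y i * (blade_sign i A * coord b (symd [set i] A) u)).
Proof.
transitivity (\big[Rplus/0]_(B : {set 'I_d}) ((\big[Rplus/0]_(i < d)
    (if B == [set i] then y i else 0)) * (cl_sign B (symd B A) * coord b (symd B A) u))).
  by case: b; rewrite /coord /clmul ?Cx_sum1 ?Cx_sum2; apply: eq_bigr => B _ /=; ring.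
under eq_bigr do rewrite big_distrl /=.
rewrite exchange_big /=; apply: eq_bigr => i _.
rewrite (bigD1 [set i]) //= eqxx big1 ?/blade_sign; first by ring.
by move=> B /negbTE ->; ring.
Qed.

Lemma coord_clmul_unitv b A i u :
  coord b A (clmul (vec (unitv i)) u) = blade_sign i A * coord b (symd [set i] A) u.
Proof. by rewrite coord_clmul_vec inner_delta. Qed.

Lemma clmul_vec_sum y u :
  clmul (vec y) u =
  \big[@ccl_add d/@ccl0 d]_(i < d) ccl_scale (y i) (clmul (vec (unitv i)) u).
Proof.
apply: coord_ext => b A; rewrite coordE coord_clmul_vec; apply: eq_bigr => i _.
by rewrite coordE coord_clmul_unitv.
Qed.

Lemma clmul_vecD y u v :
  clmul (vec y) (ccl_add u v) = ccl_add (clmul (vec y) u) (clmul (vec y) v).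
Proof.
apply: coord_ext => b A; rewrite !coordE !coord_clmul_vec -big_split /=.
by apply: eq_bigr => i _; rewrite coordE; ring.
Qed.

Lemma clmul_vecZ y r u : clmul (vec y) (ccl_scale r u) = ccl_scale r (clmul (vec y) u).
Proof.
apply: coord_ext => b A; rewrite !coordE !coord_clmul_vec big_distrr /=.
by apply: eq_bigr => i _; rewrite coordE; ring.
Qed.

Lemma clmul_vec0 y : clmul (vec y) (@ccl0 d) = @ccl0 d.
Proof.
by apply: coord_ext => b A; rewrite coord_clmul_vec big1 ?coordE // => i _; rewrite coordE; ring.
Qed.

Lemma clmul_vec_big y (I : Type) (s : seq I) (p : pred I) (F : I -> CCl d) :
  clmul (vec y) (\big[@ccl_add d/@ccl0 d]_(i <- s | p i) F i) =
  \big[@ccl_add d/@ccl0 d]_(i <- s | p i) clmul (vec y) (F i).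
Proof. exact: (big_morph _ (clmul_vecD y) (clmul_vec0 y)). Qed.

Lemma ccl_scale_big r (I : Type) (s : seq I) (p : pred I) (F : I -> CCl d) :
  ccl_scale r (\big[@ccl_add d/@ccl0 d]_(i <- s | p i) F i) =
  \big[@ccl_add d/@ccl0 d]_(i <- s | p i) ccl_scale r (F i).
Proof. 
by apply: coord_ext => b A; rewrite !coordE big_distrr /=; apply: eq_bigr => i _; rewrite coordE.
Qed.

(** * Blade signs and the Clifford relations *)

Lemma symdE A B (a : 'I_d) : (a \in symd A B) = (a \in A) (+) (a \in B).
Proof. by rewrite !inE; case: (a \in A); case: (a \in B). Qed.

Lemma symdCA A B C : symd A (symd B C) = symd B (symd A C).
Proof. by apply/setP => a; rewrite !symdE addbCA. Qed.

Lemma symdK A B : symd A (symd A B) = B.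
Proof. by apply/setP => a; rewrite !symdE addKb. Qed.

(** The pairs counted by [cl_sign] are the elements of [A] strictly below [i]; toggling [i] does not
    affect these. The intersection with [[set i]] is non-empty exactly when [i] is absent from
    [A]. *)
Lemma blade_signE i A :
  blade_sign i A = (-1) ^ #|[set a in A | (a < i)%N]| * (if i \in A then 1 else -1).
Proof.
rewrite /blade_sign /cl_sign pow_add; congr (_ * _).
  congr (_ ^ _).
  rewrite -[RHS](@card_imset _ _ (pair i)); last by move=> a a' [].
  apply: eq_card => -[a a']; rewrite inE /= inE symdE inE.
  apply/and3P/imsetP.
    move=> [/eqP -> aA lt_ai]; exists a' => //; rewrite inE lt_ai andbT.
    by move: aA; rewrite -val_eqE /= (ltn_eqF lt_ai).
  move=> [a'' + [-> ->]]; rewrite inE eqxx => /andP[aA lt_ai]; split => //.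
  by rewrite -val_eqE /= (ltn_eqF lt_ai).
case: ifP => iA.
  rewrite (_ : _ :&: _ = set0) ?cards0 //.
  by apply/setP => a; rewrite !inE; case: eqP => // ->; rewrite iA.
rewrite (_ : _ :&: _ = [set i]) ?cards1 /=; first by ring.
by apply/setP => a; rewrite !inE; case: eqP => // ->; rewrite iA.
Qed.

Lemma sign_card_symd1 (j : 'I_d) A : (-1) ^ #|symd [set j] A| = - (-1) ^ #|A|.
Proof.
have opp1M r : -1 * r = - r by ring.
have [jA|jA] := boolP (j \in A).
  have -> : symd [set j] A = A :\ j.
    by apply/setP => a; rewrite !inE; case: eqP => [->|_];
    rewrite ?(negbTE jA) ?jA ?andbF //= andbT.
  by rewrite [in RHS](cardsD1 j) jA add1n /= opp1M Ropp_involutive.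
have -> : symd [set j] A = j |: A.
  by apply/setP => a; rewrite !inE; case: eqP => [->|_];
    rewrite ?(negbTE jA) ?jA ?andbF //= andbT.
by rewrite cardsU1 jA add1n /= opp1M.
Qed.

(** Toggling [j] changes the number of elements below [i] when [j < i], and the membership of [i]
    when [j = i]; either change costs one sign. *)
Lemma blade_sign_symd1 i j A : blade_sign i (symd [set j] A) =
  if (j <= i)%N then - blade_sign i A else blade_sign i A.
Proof.
rewrite !blade_signE symdE inE.
have [lt_ji|lt_ij|/ord_inj eq_ij] := ltngtP j i.
- rewrite (_ : [set a in symd _ _ | _] = symd [set j] [set a in A | (a < i)%N]).
    by rewrite sign_card_symd1 -val_eqE /= (gtn_eqF lt_ji) /=; ring.
  by apply/setP => a; rewrite !inE; case: eqP => [->|_];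
    [rewrite lt_ji; case: (j \in A) | case: (a \in A); case: (a < i)%N].
- rewrite -val_eqE /= (ltn_eqF lt_ij) /=; congr (_ ^ _ * _); apply: eq_card => a.
  rewrite !inE; case: eqP => [->|_]; last by case: (a \in A).
  by rewrite ltnNge (ltnW lt_ij) !andbF.
- rewrite {}eq_ij eqxx.
  rewrite (_ : [set a in symd _ _ | _] = [set a in A | (a < i)%N]).
    by case: (i \in A) => /=; ring.
  by apply/setP => a; rewrite !inE; case: eqP => [->|_]; rewrite ?ltnn ?andbF //; case: (a \in A).
Qed.

Lemma blade_sign_sqr i A : blade_sign i A * blade_sign i A = 1.
Proof.
have sqr : (-1) ^ #|[set a in A | (a < i)%N]| * (-1) ^ #|[set a in A | (a < i)%N]| = 1.
  by rewrite -Rpow_mult_distr (_ : -1 * -1 = 1) ?pow1 //; ring.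
by rewrite blade_signE -[RHS]sqr; case: ifP => _; ring.
Qed.

(** For [i <> j] exactly one of [i <= j] and [j <= i] holds, so the two products carry opposite
    signs; for [i = j] each product is [- u]. *)
Lemma clmul_unitv_anti i j u :
  ccl_add (clmul (vec (unitv i)) (clmul (vec (unitv j)) u))
          (clmul (vec (unitv j)) (clmul (vec (unitv i)) u)) =
  ccl_scale (-2 * unitv i j) u.
Proof.
apply: coord_ext => b A; rewrite !coordE !coord_clmul_unitv.
rewrite !blade_sign_symd1 (symdCA [set j]).
have [<-{j}|ne_ij] := eqVneq i j.
  rewrite leqnn symdK /unitv eqxx.
  by have := blade_sign_sqr i A; set s := blade_sign i A => ss;
    transitivity (-2 * (s * s) * coord b A u); [ring|rewrite ss; ring].
have -> : unitv i j = 0 by rewrite /unitv eq_sym (negbTE ne_ij).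
by case: ltngtP => [_|_|/ord_inj/eqP]; [ring|ring|rewrite (negbTE ne_ij)].
Qed.

Lemma clmul_vec_anti y i u :
  clmul (vec (unitv i)) (clmul (vec y) u) =
  ccl_add (ccl_scale (-1) (clmul (vec y) (clmul (vec (unitv i)) u)))
          (ccl_scale (-2 * y i) u).
Proof.
rewrite (clmul_vec_sum y u) clmul_vec_big (clmul_vec_sum y (clmul _ _)).
apply: coord_ext => b A; rewrite !coordE.
transitivity (\big[Rplus/0]_(j < d) (
    -1 * (y j * coord b A (clmul (vec (unitv j)) (clmul (vec (unitv i)) u)))
   + unitv i j * (-2 * y j * coord b A u))); last first.
  rewrite big_split /= inner_delta -big_distrr /=; congr (_ * _ + _).
  by apply: eq_bigr => j _; rewrite coordE.
apply: eq_bigr => j _; rewrite clmul_vecZ coordE.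
have /(congr1 (coord b A)) := clmul_unitv_anti i j u; rewrite !coordE => anti.
by rewrite [X in y j * X](_ : _ = -2 * unitv i j * coord b A u -
  coord b A (clmul (vec (unitv j)) (clmul (vec (unitv i)) u))); [ring|lra].
Qed.

Lemma clmul_vec_sqr y u :
  clmul (vec y) (clmul (vec y) u) = ccl_scale (- norm2 y) u.
Proof.
apply: coord_ext => b A; rewrite !coordE.
set Q := coord b A _.
(* Of the two copies of [Q], one is expanded in the inner factor and one in the outer, so that their
   sum is an anticommutator covered by [clmul_vec_anti]. *)
have : 2 * Q = 2 * (- norm2 y * coord b A u); last by lra.
have Qi : Q = \big[Rplus/0]_(i < d) (y i * coord b A (clmul (vec (unitv i)) (clmul (vec y) u))).
  by rewrite /Q (clmul_vec_sum y (clmul _ _)) coordE; apply: eq_bigr => i _; rewrite coordE.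
have Qo : Q = \big[Rplus/0]_(i < d) (y i * coord b A (clmul (vec y) (clmul (vec (unitv i)) u))).
  rewrite /Q (clmul_vec_sum y u) clmul_vec_big coordE; apply: eq_bigr => i _.
  by rewrite clmul_vecZ coordE.
transitivity (\big[Rplus/0]_(i < d) (-2 * coord b A u * (y i * y i))).
  rewrite (_ : 2 * Q = Q + Q); last by lra.
  rewrite {1}Qo Qi -big_split; apply: eq_bigr => i _.
  by rewrite /= clmul_vec_anti !coordE; ring.
rewrite -big_distrr /= -/(inner y y) -/(norm2 y); ring.
Qed.

End Clifford.

(** * Scalar Dunkl operators *)

(** Uniqueness of the limit identifies the value picked by [epsilon]. *)
Lemma deriv1E (g : R -> R) (t l : R) : derivable_pt_lim g t l -> deriv1 g t = l.
Proof.
move=> gl; apply: (uniqueness_limite g t) => //; rewrite /deriv1.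
by apply: (epsilon_spec (inhabits 0) (fun l => derivable_pt_lim g t l)); exists l.
Qed.

(** * Calculus of partial derivatives on real functions *)

Section ScalarDunkl.
Variable d : nat.
Implicit Types (a x : vecR d) (g h : vecR d -> R) (i j : 'I_d).

Definition partial i g x : R := deriv1 (fun t => g (upd x i t)) (x i).

Definition pdiff g : Prop :=
  forall x i, exists l, derivable_pt_lim (fun t => g (upd x i t)) (x i) l.

Lemma pdiffP g : pdiff g ->
  forall x i, derivable_pt_lim (fun t => g (upd x i t)) (x i) (partial i g x).
Proof. by move=> dg x i; rewrite /partial; have [l gl] := dg x i; rewrite (deriv1E gl). Qed.

Lemma upd_id x i : upd x i (x i) = x.
Proof. by apply: functional_extensionality => j; rewrite /upd; case: eqP => [->|]. Qed.

Lemma derivable_upd i j x : derivable_pt_lim (fun t => upd x i t j) (x i) (unitv i j).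
Proof.
rewrite /upd /unitv; case: ifP => _; [exact: derivable_pt_lim_id | exact: derivable_pt_lim_const].
Qed.

Lemma derivable_mul g h x i : pdiff g -> pdiff h ->
  derivable_pt_lim (fun t => g (upd x i t) * h (upd x i t)) (x i)
    (partial i g x * h x + g x * partial i h x).
Proof.
move=> dg dh.
by have := derivable_pt_lim_mult _ _ _ _ _ (pdiffP dg x i) (pdiffP dh x i); rewrite upd_id.
Qed.

Lemma pdiff_mul g h : pdiff g -> pdiff h -> pdiff (fun x => g x * h x).
Proof. by move=> dg dh x i; eexists; apply: derivable_mul. Qed.

Lemma partial_mul g h i x : pdiff g -> pdiff h ->
  partial i (fun x => g x * h x) x = partial i g x * h x + g x * partial i h x.
Proof. by move=> dg dh; apply: deriv1E; apply: derivable_mul. Qed.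

Lemma pdiff_var j : pdiff (fun x => x j).
Proof. by move=> x i; eexists; apply: derivable_upd. Qed.

Lemma partial_var i j x : partial i (fun x => x j) x = unitv i j.
Proof. by apply: deriv1E; apply: derivable_upd. Qed.

Lemma pdiff_const c : pdiff (fun _ => c).
Proof. by move=> x i; exists 0; apply: derivable_pt_lim_const. Qed.

Lemma partial_const c i x : partial i (fun _ => c) x = 0.
Proof. by apply: deriv1E; apply: derivable_pt_lim_const. Qed.

Section LinearCombination.
Variables (I : Type) (s : seq I) (p : pred I) (c : I -> R) (G : I -> vecR d -> R).
Hypothesis dG : forall l, p l -> pdiff (G l).
Let F := fun x => \big[Rplus/0]_(l <- s | p l) (c l * G l x).

Lemma derivable_sum x i :
  derivable_pt_lim (fun t => F (upd x i t)) (x i)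
    (\big[Rplus/0]_(l <- s | p l) (c l * partial i (G l) x)).
Proof.
rewrite /F; elim: s => [|l s' IH].
  rewrite big_nil (_ : (fun _ => _) = fun _ => 0); first exact: derivable_pt_lim_const.
  by apply: functional_extensionality => t; rewrite big_nil.
have [pl|pl] := boolP (p l).
  rewrite big_cons pl (_ : (fun _ => _) = plus_fct (mult_real_fct (c l) (fun t => G l (upd x i t)))
      (fun t => \big[Rplus/0]_(l <- s' | p l) (c l * G l (upd x i t)))).
    by apply: derivable_pt_lim_plus IH; apply: derivable_pt_lim_scal; apply: (pdiffP (dG pl)).
  by apply: functional_extensionality => t; rewrite big_cons pl.
rewrite big_cons (negbTE pl) (_ : (fun _ => _) =
   (fun t => \big[Rplus/0]_(l <- s' | p l) (c l * G l (upd x i t)))) //.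
by apply: functional_extensionality => t; rewrite big_cons (negbTE pl).
Qed.

Lemma pdiff_sum : pdiff F.
Proof. by move=> x i; eexists; apply: derivable_sum. Qed.

Lemma partial_sum i x :
  partial i F x = \big[Rplus/0]_(l <- s | p l) (c l * partial i (G l) x).
Proof. by apply: deriv1E; apply: derivable_sum. Qed.
End LinearCombination.

(** Homogeneity in infinitesimal form: Euler's identity, the form in which the degree enters the
    commutation rule. *)
Definition euler_homogeneous (m : nat) g : Prop :=
  pdiff g /\ forall x, \big[Rplus/0]_(i < d) (x i * partial i g x) = INR m * g x.

Lemma euler_mul m m' g h : euler_homogeneous m g -> euler_homogeneous m' h ->
  euler_homogeneous (m + m')%N (fun x => g x * h x).
Proof.
move=> [dg Eg] [dh Eh]; split; first exact: pdiff_mul.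
move=> x; rewrite plus_INR.
transitivity (\big[Rplus/0]_(i < d) ((x i * partial i g x) * h x + (x i * partial i h x) * g x)).
  by apply: eq_bigr => i _; rewrite partial_mul //; ring.
by rewrite big_split /= -!big_distrl /= Eg Eh; ring.
Qed.

Lemma euler_var j : euler_homogeneous 1 (fun x => x j).
Proof.
split=> [|x]; first exact: pdiff_var.
transitivity (\big[Rplus/0]_(i < d) (unitv j i * x i)); last by rewrite inner_delta /=; ring.
apply: eq_bigr => i _; rewrite partial_var /unitv eq_sym.
by ring.
Qed.

Lemma euler_const c : euler_homogeneous 0 (fun _ => c).
Proof.
split=> [|x]; first exact: pdiff_const.
by rewrite big1 /= => [|i _]; rewrite ?partial_const; ring.
Qed.

Lemma euler_pow j m : euler_homogeneous m (fun x => x j ^ m).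
Proof.
elim: m => [|m IH] /=; first exact: euler_const.
exact: (euler_mul (euler_var j) IH).
Qed.

Lemma euler_monomial (I : Type) (s : seq I) (b : I -> nat) (j : I -> 'I_d) :
  euler_homogeneous (\sum_(i <- s) b i)%N
    (fun x => \big[Rmult/1]_(i <- s) (x (j i) ^ b i)).
Proof.
elim: s => [|l s IH].
  rewrite big_nil (_ : (fun _ => _) = fun _ => 1); first exact: euler_const.
  by apply: functional_extensionality => x; rewrite big_nil.
rewrite big_cons (_ : (fun _ => _) = fun x : vecR d =>
    x (j l) ^ b l * \big[Rmult/1]_(i <- s) (x (j i) ^ b i)).
  exact: euler_mul (euler_pow _ _) IH.
by apply: functional_extensionality => x; rewrite big_cons.
Qed.

Lemma euler_sum m (I : Type) (s : seq I) (p : pred I) (c : I -> R) (G : I -> vecR d -> R) :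
  (forall l, p l -> euler_homogeneous m (G l)) ->
  euler_homogeneous m (fun x => \big[Rplus/0]_(l <- s | p l) (c l * G l x)).
Proof.
move=> EG; have dG l : p l -> pdiff (G l) by move=> /EG[].
split=> [|x]; first exact: pdiff_sum.
transitivity (\big[Rplus/0]_(i < d) \big[Rplus/0]_(l <- s | p l) (x i * (c l * partial i (G l) x))).
  by apply: eq_bigr => i _; rewrite (partial_sum s c dG) big_distrr.
rewrite exchange_big big_distrr /=; apply: eq_bigr => l pl.
have [_ /(_ x) E] := EG _ pl.
transitivity (c l * (INR m * G l x)); last by ring.
by rewrite -E big_distrr /=; apply: eq_bigr => i _; ring.
Qed.

(** * Reflection difference quotients and scalar Dunkl operators *)

Definition diff_quot a g x : R :=
  if Req_EM_T (inner a x) 0 then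
    2 / norm2 a * \big[Rplus/0]_(j < d) (a j * partial j g x)
  else / inner a x * (g x + -1 * g (refl a x)).

Lemma refl_orth a x : inner a x = 0 -> refl a x = x.
Proof.
move=> ax; apply: functional_extensionality => i; rewrite /refl ax /Rdiv; ring.
Qed.

(** On the hyperplane both sides are zero, because the reflection fixes [x]. *)
Lemma diff_quot_inner a g x : inner a x * diff_quot a g x = g x - g (refl a x).
Proof.
rewrite /diff_quot; case: Req_EM_T => /= ax; last by field.
by rewrite refl_orth // ax; ring.
Qed.

Lemma norm2_neq0 a : a <> @vzero d -> norm2 a <> 0.
Proof.
move=> a0 na; apply: a0; apply: functional_extensionality => i.
move: na; rewrite /norm2 /inner (bigD1 i) //=; set rest := bigop.body _ _ _.
have : 0 <= rest.
  by rewrite /rest; apply: (big_ind (fun r => 0 <= r)) => [||j _];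
    [lra | move=> *; lra | exact: Rle_0_sqr].
move=> rest0 sum0; have sq0 : 0 <= a i * a i := Rle_0_sqr _.
by have /Rmult_integral[] : a i * a i = 0 by lra.
Qed.

(** Off the hyperplane, the [j]-th coordinate of [refl a x] differs from [x j] by a multiple of
    [inner a x], which cancels the denominator. On it, the Leibniz rule for the directional
    derivative gives the same formula. *)
Lemma diff_quot_mul_var a g j x : pdiff g -> norm2 a <> 0 ->
  diff_quot a (fun x => x j * g x) x =
  x j * diff_quot a g x + 2 * a j / norm2 a * g (refl a x).
Proof.
move=> dg a0; rewrite /diff_quot; case: Req_EM_T => /= ax; last first.
  by rewrite /refl; field.
rewrite (refl_orth ax).
transitivity (2 / norm2 a *
    \big[Rplus/0]_(i < d) (unitv j i * (a i * g x) + x j * (a i * partial i g x))).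
  congr (_ * _); apply: eq_bigr => i _.
  rewrite (partial_mul _ _ (pdiff_var j) dg) partial_var /unitv eq_sym; ring.
by rewrite big_split /= inner_delta -big_distrr /=; field.
Qed.

Variables (Rp : seq (vecR d)) (k : vecR d -> R).
Hypothesis Rp_neq0 : forall a, In a Rp -> norm2 a <> 0.

Definition dunkl_scalar i g x : R :=
  partial i g x + \big[Rplus/0]_(a <- Rp) (k a * a i * diff_quot a g x).

Lemma dunkl_scalar_sum (I : Type) (s : seq I) (p : pred I) (c : I -> R)
    (G : I -> vecR d -> R) i x : (forall l, p l -> pdiff (G l)) ->
  dunkl_scalar i (fun x => \big[Rplus/0]_(l <- s | p l) (c l * G l x)) x =
  \big[Rplus/0]_(l <- s | p l) (c l * dunkl_scalar i (G l) x).
Proof.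
move=> dG; rewrite /dunkl_scalar (partial_sum s c dG).
under [in RHS]eq_bigr do rewrite Rmult_plus_distr_l big_distrr /=.
rewrite big_split exchange_big /=; congr (_ + _); apply: eq_bigr => a _.
transitivity (k a * a i * \big[Rplus/0]_(l <- s | p l) (c l * diff_quot a (G l) x)); last first.
  by rewrite big_distrr /=; apply: eq_bigr => l _; ring.
congr (_ * _); rewrite /diff_quot; case: Req_EM_T => /= ax.
  transitivity (2 / norm2 a *
      \big[Rplus/0]_(j < d) \big[Rplus/0]_(l <- s | p l) (a j * (c l * partial j (G l) x))).
    by congr (_ * _); apply: eq_bigr => j _; rewrite (partial_sum s c dG) big_distrr.
  rewrite exchange_big big_distrr /=; apply: eq_bigr => l _.
  rewrite !big_distrr /=; apply: eq_bigr => j _; ring.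
rewrite [-1 * _]big_distrr -big_split big_distrr /=.
by apply: eq_bigr => l _; ring.
Qed.

(** The commutator of [T_i] with multiplication by [x_j]: a Kronecker delta plus a weighted sum of
    reflections, symmetric in [i] and [j]. *)
Lemma dunkl_scalar_mul_var g i j x : pdiff g ->
  dunkl_scalar i (fun x => x j * g x) x =
  x j * dunkl_scalar i g x + unitv i j * g x
  + \big[Rplus/0]_(a <- Rp) (2 * k a * a i / norm2 a * a j * g (refl a x)).
Proof.
move=> dg; rewrite /dunkl_scalar (partial_mul _ _ (pdiff_var j) dg) partial_var.
rewrite Rmult_plus_distr_l [x j * bigop.body _ _ _]big_distrr /=.
transitivity (unitv i j * g x + x j * partial i g x + \big[Rplus/0]_(a <- Rp)
   (x j * (k a * a i * diff_quot a g x) + 2 * k a * a i / norm2 a * a j * g (refl a x))).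
  congr (_ + _); apply: eq_big_In => a /Rp_neq0 a0.
  by rewrite diff_quot_mul_var //; field.
by rewrite big_split /=; ring.
Qed.

(** Summing [x i * a i] over [i] rebuilds [inner a x], and [diff_quot_inner] then clears the
    quotient. *)
Lemma dunkl_scalar_euler m g x : euler_homogeneous m g ->
  \big[Rplus/0]_(i < d) (x i * dunkl_scalar i g x) =
  INR m * g x + \big[Rplus/0]_(a <- Rp) (k a * (g x - g (refl a x))).
Proof.
move=> [_ Eg]; rewrite /dunkl_scalar.
transitivity (\big[Rplus/0]_(i < d) (x i * partial i g x +
    \big[Rplus/0]_(a <- Rp) (x i * (k a * a i * diff_quot a g x)))).
  by apply: eq_bigr => i _; rewrite Rmult_plus_distr_l big_distrr.
rewrite big_split exchange_big Eg /=; congr (_ + _); apply: eq_bigr => a _.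
rewrite -diff_quot_inner /inner big_distrl big_distrr /=.
by apply: eq_bigr => i _; ring.
Qed.

End ScalarDunkl.

(** * Gamma and the Laguerre coefficients *)

Definition rising (z : R) (m : nat) : R := \big[Rmult/1]_(j < m) (z + INR j).

(** The sequence whose limit defines [Gamma], with its denominator written as a Pochhammer
    symbol. *)
Definition gauss (z : R) (m : nat) : R :=
  INR (fact m) * Rpower (INR m) z / rising z m.+1.

Lemma risingS z m : rising z m.+1 = rising z m * (z + INR m).
Proof. by rewrite /rising big_ord_recr. Qed.

Lemma rising_shift z m : z * rising (z + 1) m = rising z m.+1.
Proof.
rewrite /rising big_ord_recl; congr (_ * _); first by rewrite /= Rplus_0_r.
by apply: eq_bigr => j _; rewrite lift0 S_INR; ring.
Qed.

Lemma rising_gt0 z m : 0 < z -> 0 < rising z m.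
Proof.
move=> z0; apply: (big_ind (fun r => 0 < r)) => [||j _]; first lra.
  exact: Rmult_lt_0_compat.
by have := pos_INR j; lra.
Qed.

Lemma Rpower_gt0 x y : 0 < Rpower x y.
Proof. exact: exp_pos. Qed.

Lemma gauss_gt0 z m : 0 < z -> 0 < gauss z m.
Proof.
move=> z0; apply: Rdiv_lt_0_compat; last exact: rising_gt0.
by apply: Rmult_lt_0_compat; [exact: INR_fact_lt_0 | exact: Rpower_gt0].
Qed.

(* Weighted AM-GM: average the tangent inequalities [exp u >= 1 + u] at
   [u = (1 - z) t] and [u = - z t]. *)
Lemma exp_bernoulli z t : 0 <= z <= 1 -> exp (z * t) <= 1 - z + z * exp t.
Proof.
move=> z01; have := exp_ineq1_le ((1 - z) * t); have := exp_ineq1_le (- (z * t)).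
have -> : exp t = exp (z * t) * exp ((1 - z) * t) by rewrite -exp_plus; congr exp; ring.
have inv : exp (z * t) * exp (- (z * t)) = 1 by rewrite -exp_plus Rplus_opp_r exp_0.
move: inv (exp_pos (z * t)).
move: (exp (z * t)) (exp (- (z * t))) (exp ((1 - z) * t)) => q q' r inv q0 q'1 r1.
have h1 : q * (1 - z * t) <= 1 by nra.
have h2 : q * (1 + (1 - z) * t) <= q * r by nra.
have z0 : 0 <= z by lra.
have z1 : 0 <= 1 - z by lra.
have := Rmult_le_compat_l _ _ _ z0 h2; have := Rmult_le_compat_l _ _ _ z1 h1; lra.
Qed.

(** Bernoulli's inequality for exponents in [[0, 1]], applied to the ratio [a / b]. *)
Lemma Rpower_bernoulli a b z : 0 < a -> 0 < b -> 0 <= z <= 1 ->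
  Rpower a z <= Rpower b z * (1 - z + z * (a / b)).
Proof.
move=> a0 b0 z01.
have -> : a / b = exp (ln a - ln b).
  rewrite /Rminus -ln_Rinv // -ln_mult //; last exact: Rinv_0_lt_compat.
  by rewrite exp_ln //; apply: Rdiv_lt_0_compat.
have -> : Rpower a z = Rpower b z * exp (z * (ln a - ln b)).
  by rewrite /Rpower -exp_plus; congr exp; ring.
apply: Rmult_le_compat_l; first by apply: Rlt_le; apply: Rpower_gt0.
exact: exp_bernoulli.
Qed.

Lemma INRS_gt0 m : 0 < INR m.+1.
Proof. by apply: lt_0_INR; apply/ltP. Qed.

(** Bernoulli with bases [m + 1] and [m + 2] reduces the claim to [(N - z) (N + z) <= N^2], where
    [N = m + 2]. Starting at [m.+1] keeps the base of [Rpower] positive; at 0 the logarithm takes a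
    default value. *)
Lemma gauss_growing z : 0 < z <= 1 -> Un_growing (fun m => gauss z m.+1).
Proof.
move=> z01 m; rewrite /gauss (risingS _ m.+2).
have m0 := INRS_gt0 m; have m1 := INRS_gt0 m.+1.
have Q0 : 0 < rising z m.+2 by apply: rising_gt0; lra.
have F0 := INR_fact_lt_0 m.+1.
have -> : INR (fact m.+2) = INR m.+2 * INR (fact m.+1) by rewrite -mult_INR.
have B : Rpower (INR m.+1) z <= Rpower (INR m.+2) z * (1 - z + z * (INR m.+1 / INR m.+2)).
  by apply: Rpower_bernoulli => //; lra.
apply: (Rle_trans _ (INR (fact m.+1) * (Rpower (INR m.+2) z * (1 - z + z * (INR m.+1 / INR m.+2)))
    / rising z m.+2)).
  apply: Rmult_le_compat_r; first by apply: Rlt_le; apply: Rinv_0_lt_compat.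
  by apply: Rmult_le_compat_l B; lra.
have -> : INR m.+1 = INR m.+2 - 1 by rewrite (S_INR m.+1); ring.
have P0 := Rpower_gt0 (INR m.+2) z.
set N := INR m.+2 in m1 P0 *; set F := INR (fact _) in F0 *; set p := Rpower _ _ in P0 *.
set Q := rising _ _ in Q0 *.
have -> : F * (p * (1 - z + z * ((N - 1) / N))) / Q = (F * p / Q) * (1 - z / N) by field; lra.
have -> : N * F * p / (Q * (z + N)) = (F * p / Q) * (N / (z + N)) by field; lra.
apply: Rmult_le_compat_l.
  by apply: Rlt_le; apply: Rdiv_lt_0_compat => //; apply: Rmult_lt_0_compat.
apply: (Rmult_le_reg_r (N * (z + N))); first nra.
have -> : (1 - z / N) * (N * (z + N)) = (N - z) * (z + N) by field; lra.
have -> : N / (z + N) * (N * (z + N)) = N * N by field; lra.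
nra.
Qed.

Lemma gauss_bounded z m : 0 < z <= 1 -> gauss z m.+1 <= / z.
Proof.
move=> z01.
(* A decreasing majorant of [gauss], with the power taken at [j + 1] instead of [j]; its first term
   is [/ z]. *)
pose v j := INR (fact j) * Rpower (INR j.+1) z / rising z j.+1.
have v_decr j : v j.+1 <= v j.
  rewrite /v (risingS _ j.+1); have m0 := INRS_gt0 j; have m1 := INRS_gt0 j.+1.
  have Q0 : 0 < rising z j.+1 by apply: rising_gt0; lra.
  have F0 := INR_fact_lt_0 j.
  have -> : INR (fact j.+1) = INR j.+1 * INR (fact j) by rewrite -mult_INR.
  have B : Rpower (INR j.+2) z <= Rpower (INR j.+1) z * (1 - z + z * (INR j.+2 / INR j.+1)).
    by apply: Rpower_bernoulli => //; lra.
  rewrite (S_INR j.+1) in B *.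
  set N := INR j.+1 in m0 m1 B *; set F := INR (fact _) in F0 *; set Q := rising _ _ in Q0 *.
  apply: (Rle_trans _ (N * F * (Rpower N z * (1 - z + z * ((N + 1) / N))) / (Q * (z + N)))).
    apply: Rmult_le_compat_r; first by apply: Rlt_le; apply: Rinv_0_lt_compat; nra.
    by apply: Rmult_le_compat_l B; nra.
  (* The Bernoulli factor is exactly [(N + z) / N], which cancels the new factor [z + N] of the
     Pochhammer symbol. *)
  by apply: Req_le; field; lra.
have v_bound j : v j <= / z.
  elim: j => [|j IH]; last exact: Rle_trans IH.
  rewrite /v /rising big_ord_recl big_ord0 /= Rplus_0_r Rmult_1_l.
  by rewrite /Rpower ln_1 Rmult_0_r exp_0; apply: Req_le; field; lra.
apply: Rle_trans (v_bound m.+1); rewrite /gauss /v.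
have Q0 : 0 < rising z m.+2 by apply: rising_gt0; lra.
apply: Rmult_le_compat_r; first by apply: Rlt_le; apply: Rinv_0_lt_compat.
apply: Rmult_le_compat_l; first by apply: Rlt_le; apply: INR_fact_lt_0.
apply: Rle_Rpower_l; first lra.
by split; [exact: INRS_gt0 | rewrite (S_INR m.+1); lra].
Qed.

Lemma gauss_cv_unit z : 0 < z <= 1 -> exists2 l, 0 < l & Un_cv (gauss z) l.
Proof.
move=> z01; have grow := gauss_growing z01.
have [|l lim] := growing_cv (fun m => gauss z m.+1) grow.
  by exists (/ z) => _ [m ->]; apply: gauss_bounded.
exists l; last first.
  by apply: (CV_shift _ 1%nat); apply: Un_cv_ext lim => m; rewrite plusE addn1.
(* The limit of a growing sequence is at least its first term, which is positive. *)
apply: Rlt_le_trans (growing_ineq _ _ grow lim 0%nat).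
by apply: gauss_gt0; lra.
Qed.

Lemma ratio_cv z : 0 < z -> Un_cv (fun m => INR m / (z + INR m + 1)) 1.
Proof.
move=> z0 e e0; have [N Ne] := INR_archimed e (z + 1) e0; exists N => m /le_INR Nm.
have m0 := pos_INR m.
rewrite /Rdist (_ : _ - 1 = - ((z + 1) / (z + INR m + 1))); last by field; lra.
rewrite Rabs_Ropp Rabs_pos_eq; last by apply: Rlt_le; apply: Rdiv_lt_0_compat; lra.
apply: (Rmult_lt_reg_r (z + INR m + 1)); first lra.
rewrite (_ : _ / _ * _ = z + 1); last by field; lra.
have : INR N * e <= INR m * e by apply: Rmult_le_compat_r; lra.
have : 0 < e * (z + 1) by apply: Rmult_lt_0_compat; lra.
lra.
Qed.

(** The functional equation of [Gamma] before the limit; the correction factor tends to 1 by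
    [ratio_cv]. *)
Lemma gaussS z m : 0 < z ->
  gauss (z + 1) m.+1 = z * (gauss z m.+1 * (INR m.+1 / (z + INR m.+1 + 1))).
Proof.
move=> z0; have m0 := INRS_gt0 m.
have Q0 := rising_gt0 m.+2 z0.
rewrite /gauss (_ : rising (z + 1) m.+2 = rising z m.+2 * (z + INR m.+1 + 1) / z).
  by rewrite Rpower_plus Rpower_1 //; field; lra.
apply: (Rmult_eq_reg_l z); last lra.
by rewrite rising_shift risingS (S_INR m.+1); field; lra.
Qed.

(** Induction on an integer bound for [z - 1]: steps from [z] to [z - 1] lead down to the unit
    interval. *)
Lemma gauss_cv z : 0 < z -> exists2 l, 0 < l & Un_cv (gauss z) l.
Proof.
move=> z0; have [N zN] := INR_unbounded z.
have {}zN : z <= INR N + 1 by lra.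
elim: N z z0 zN => [|N IH] z z0 zN; first by apply: gauss_cv_unit; move: zN => /=; lra.
have [z1|z1] := Rle_lt_dec z 1; first exact: gauss_cv_unit.
have [||l l0 lim] := IH (z - 1); [lra | by move: zN; rewrite S_INR; lra |].
(* The limit read off from [gaussS] at [z - 1], left as a product to match [CV_mult]; the trailing 1
   is the limit of the correction factor. *)
exists ((z - 1) * (l * 1)); first by rewrite Rmult_1_r; apply: Rmult_lt_0_compat; lra.
apply: (CV_shift _ 1%nat); apply: (Un_cv_ext (fun m => (z - 1) *
    (gauss (z - 1) (m + 1)%coq_nat * (INR (m + 1)%coq_nat / (z - 1 + INR (m + 1)%coq_nat + 1))))).
  move=> m; rewrite plusE addn1 -gaussS; last lra.
  by congr gauss; ring.
apply: (CV_shift' (fun m => (z - 1) * (gauss (z - 1) m * (INR m / (z - 1 + INR m + 1)))) 1%nat).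
apply: CV_mult; first by move=> e e0; exists 0%nat => *; rewrite Rdist_eq.
by apply: CV_mult => //; apply: ratio_cv; lra.
Qed.

Lemma Gamma_lim z l : Un_cv (gauss z) l -> Gamma z = l.
Proof.
move=> lim; apply: (UL_sequence (gauss z)) => //.
by apply: (epsilon_spec (inhabits 0) (fun l => Un_cv (gauss z) l)); exists l.
Qed.

Lemma Gamma_gt0 z : 0 < z -> 0 < Gamma z.
Proof. by move=> /gauss_cv[l l0 /Gamma_lim ->]. Qed.

Lemma GammaS z : 0 < z -> Gamma (z + 1) = z * Gamma z.
Proof.
move=> z0; have [l _ lim] := gauss_cv z0; rewrite (Gamma_lim lim).
apply: Gamma_lim; rewrite -[l in z * l]Rmult_1_r.
apply: (CV_shift _ 1%nat); apply: (Un_cv_ext (fun m => z *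
    (gauss z (m + 1)%coq_nat * (INR (m + 1)%coq_nat / (z + INR (m + 1)%coq_nat + 1))))).
  by move=> m; rewrite plusE addn1 -gaussS.
apply: (CV_shift' (fun m => z * (gauss z m * (INR m / (z + INR m + 1)))) 1%nat).
apply: CV_mult; first by move=> e e0; exists 0%nat => *; rewrite Rdist_eq.
by apply: CV_mult => //; apply: ratio_cv.
Qed.

(** The coefficient of [(- y) ^ j], sign included in the power: with [y = norm2 x] this power is the
    Clifford square of [x] to the [j]. *)
Definition laguerre_coef (al : R) (m j : nat) : R :=
  Gamma (INR m + al + 1) / (INR (fact j) * INR (fact (m - j)%N) * Gamma (INR j + al + 1)).

(** * Recurrences between Laguerre coefficients *)

Section LaguerreCoefficients.
Variable al : R.
Hypothesis al_gt : 0 < al + 1.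

Lemma GammaS_nat j : Gamma (INR j + (al + 1) + 1) = (INR j + al + 1) * Gamma (INR j + al + 1).
Proof.
rewrite -GammaS; last by have := pos_INR j; lra.
by congr Gamma; ring.
Qed.

Lemma Gamma_nat_gt0 j : 0 < Gamma (INR j + al + 1).
Proof. by apply: Gamma_gt0; have := pos_INR j; lra. Qed.

Lemma INR_factS j : INR (fact j.+1) = INR j.+1 * INR (fact j).
Proof. by rewrite -mult_INR. Qed.

(** The leading coefficient does not depend on [al], so it agrees for [al] and [al + 1]. *)
Lemma laguerre_coef_diag m : laguerre_coef al m m = / INR (fact m).
Proof.
rewrite /laguerre_coef subnn /=.
by have := Gamma_nat_gt0 m; have := INR_fact_lt_0 m => *; field; lra.
Qed.

(* [L_m^al - (L_m^al)' = L_m^(al+1)] *)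
Lemma laguerre_coef_raise m j : (j < m)%N ->
  INR j.+1 * laguerre_coef al m j.+1 + laguerre_coef al m j = laguerre_coef (al + 1) m j.
Proof.
move=> lt_jm; rewrite /laguerre_coef !GammaS_nat.
have -> : (m - j = (m - j.+1).+1)%N by rewrite subnSK.
(* Truncated subtraction is confined to [m - j.+1], which [field] can treat as an atom. *)
have mE : INR m = INR (m - j.+1) + INR j + 1.
  by rewrite -plus_INR -S_INR plusE -addnS subnK.
have -> : Gamma (INR j.+1 + al + 1) = (INR j + al + 1) * Gamma (INR j + al + 1).
  by rewrite -GammaS_nat S_INR; congr Gamma; ring.
rewrite !INR_factS !S_INR mE.
have := Gamma_nat_gt0 j; have := INR_fact_lt_0 j; have := INR_fact_lt_0 (m - j.+1)%N.
have := pos_INR j; have := pos_INR (m - j.+1)%N.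
by move=> *; field; repeat split; lra.
Qed.

(* [y (L_m^(al+1))' + (al + 1 - y) L_m^(al+1) = (m + 1) L_(m+1)^al] *)
Lemma laguerre_coef_lower m j : (j < m)%N ->
  (INR j.+1 + al + 1) * laguerre_coef (al + 1) m j.+1 + laguerre_coef (al + 1) m j =
  INR m.+1 * laguerre_coef al m.+1 j.+1.
Proof.
move=> lt_jm; rewrite /laguerre_coef !GammaS_nat subSS.
have -> : (m - j = (m - j.+1).+1)%N by rewrite subnSK.
have mE : INR m = INR (m - j.+1) + INR j + 1.
  by rewrite -plus_INR -S_INR plusE -addnS subnK.
have GS i : Gamma (INR i.+1 + al + 1) = (INR i + al + 1) * Gamma (INR i + al + 1).
  by rewrite -GammaS_nat S_INR; congr Gamma; ring.
rewrite !GS !INR_factS !S_INR mE.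
have := Gamma_nat_gt0 j; have := INR_fact_lt_0 j; have := INR_fact_lt_0 (m - j.+1)%N.
have := pos_INR j; have := pos_INR (m - j.+1)%N.
by move=> *; field; repeat split; lra.
Qed.

(** The constant term of the identity behind [laguerre_coef_lower], where no preceding coefficient
    contributes. *)
Lemma laguerre_coef_lower0 m :
  (al + 1) * laguerre_coef (al + 1) m 0 = INR m.+1 * laguerre_coef al m.+1 0.
Proof.
rewrite /laguerre_coef !GammaS_nat !subn0.
have -> : Gamma (INR m.+1 + al + 1) = (INR m + al + 1) * Gamma (INR m + al + 1).
  by rewrite -GammaS_nat S_INR; congr Gamma; ring.
rewrite !INR_factS !S_INR /=.
have := Gamma_nat_gt0 0; have := INR_fact_lt_0 m; have := pos_INR m => /=.
by move=> *; field; repeat split; lra.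
Qed.

End LaguerreCoefficients.

(** * The Dunkl-Dirac operator *)

Section DunklDirac.
Variables (d : nat) (Rp : seq (vecR d)) (k : vecR d -> R).
Hypothesis Rp_neq0 : forall a, In a Rp -> norm2 a <> 0.
Implicit Types (f : CFun d) (x : vecR d).

Definition homogeneous (m : nat) f : Prop :=
  forall b A, euler_homogeneous m (fun x => coord b A (f x)).

Lemma coord_dunkl b A i f x :
  coord b A (dunkl Rp k i f x) = dunkl_scalar Rp k i (fun y => coord b A (f y)) x.
Proof.
have coord_pderiv j : coord b A (pderiv j f x) = partial j (fun y => coord b A (f y)) x.
  by case: b.
rewrite /dunkl coord_add coord_sum coord_pderiv; congr (_ + _).
apply: eq_bigr => a _; rewrite coord_scale /dunkl_diff /diff_quot; congr (_ * _).
case: Req_EM_T => /= _; last by rewrite !coordE.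
by rewrite !coordE; congr (_ * _); apply: eq_bigr => j _; rewrite coordE coord_pderiv.
Qed.

(** Puts the constant sign first, giving the linear combination expected by [euler_sum] and
    [dunkl_scalar_sum]. *)
Lemma coord_clmul_vec_fun b A f :
  (fun y => coord b A (clmul (vec y) (f y))) =
  fun y => \big[Rplus/0]_(j < d) (blade_sign j A * (y j * coord b (symd [set j] A) (f y))).
Proof.
apply: functional_extensionality => y; rewrite coord_clmul_vec.
by apply: eq_bigr => j _; ring.
Qed.

Lemma homogeneous_clmul_vec m f :
  homogeneous m f -> homogeneous m.+1 (fun y => clmul (vec y) (f y)).
Proof.
move=> hf b A; rewrite coord_clmul_vec_fun; apply: euler_sum => j _.
exact: (euler_mul (euler_var j) (hf b _)).
Qed.

Lemma dunkl_clmul_vec m f i x : homogeneous m f ->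
  dunkl Rp k i (fun y => clmul (vec y) (f y)) x =
  ccl_add (ccl_add (clmul (vec x) (dunkl Rp k i f x)) (clmul (vec (unitv i)) (f x)))
    (\big[@ccl_add d/@ccl0 d]_(a <- Rp)
       ccl_scale (2 * k a * a i / norm2 a) (clmul (vec a) (f (refl a x)))).
Proof.
move=> hf; apply: coord_ext => b A.
have df j : pdiff (fun y => coord b (symd [set j] A) (f y)) by case: (hf b (symd [set j] A)).
rewrite coord_dunkl coord_clmul_vec_fun !coordE.
rewrite (dunkl_scalar_sum Rp k); last first.
  by move=> j _; apply: pdiff_mul; [exact: pdiff_var | exact: df].
rewrite !coord_clmul_vec.
transitivity (\big[Rplus/0]_(j < d) (
    x j * (blade_sign j A * coord b (symd [set j] A) (dunkl Rp k i f x))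
    + unitv i j * (blade_sign j A * coord b (symd [set j] A) (f x))
    + \big[Rplus/0]_(a <- Rp) (2 * k a * a i / norm2 a *
         (a j * (blade_sign j A * coord b (symd [set j] A) (f (refl a x))))))).
  apply: eq_bigr => j _; rewrite (dunkl_scalar_mul_var k Rp_neq0) ?coord_dunkl; last exact: df.
  rewrite 2!Rmult_plus_distr_l big_distrr /=; congr (_ + _ + _); [ring | ring |].
  by apply: eq_bigr => a _; rewrite /Rdiv; ring.
rewrite !big_split /= exchange_big /=; congr (_ + _).
apply: eq_bigr => a _; rewrite coordE coord_clmul_vec big_distrr /=.
by apply: eq_bigr => j _.
Qed.

Lemma norm2_unitv i : norm2 (@unitv d i) = 1.
Proof. by rewrite /norm2 /inner inner_delta /unitv eqxx. Qed.

Lemma sum_const_ord (r : R) : \big[Rplus/0]_(i < d) r = INR d * r.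
Proof.
elim: d => [|n IH]; first by rewrite big_ord0 /=; ring.
by rewrite big_ord_recr IH S_INR /=; ring.
Qed.

Lemma dirac_clmul_vec m f x : homogeneous m f ->
  dirac Rp k (fun y => clmul (vec y) (f y)) x =
  ccl_add (ccl_scale (-1) (clmul (vec x) (dirac Rp k f x)))
          (ccl_scale (- (2 * INR m + mu_k Rp k)) (f x)).
Proof.
move=> hf; apply: coord_ext => b A; rewrite /dirac !coordE clmul_vec_big coordE.
(* The anticommutator of [e_i] and [x] gives the first two groups, [e_i e_i = -1] the third, and the
   reflected terms of the product rule the fourth. *)
transitivity (\big[Rplus/0]_(i < d) (
   -1 * coord b A (clmul (vec x) (clmul (vec (unitv i)) (dunkl Rp k i f x)))
   + -2 * (x i * dunkl_scalar Rp k i (fun y => coord b A (f y)) x)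
   + -1 * coord b A (f x)
   + \big[Rplus/0]_(a <- Rp) (2 * k a / norm2 a * (a i * 
        coord b A (clmul (vec (unitv i)) (clmul (vec a) (f (refl a x)))))))).
  apply: eq_bigr => i _; rewrite (dunkl_clmul_vec _ _ hf) -coord_dunkl.
  move: (dunkl _ _ _ _ _) => Tf; rewrite !clmul_vecD (clmul_vec_anti x).
  rewrite clmul_vec_sqr norm2_unitv clmul_vec_big !coordE.
  congr (_ + _); first ring.
  by apply: eq_bigr => a _; rewrite clmul_vecZ !coordE /Rdiv; ring.
rewrite !big_split /= -!big_distrr /= sum_const_ord (dunkl_scalar_euler Rp k x (hf b A)).
rewrite exchange_big /=.
(* Summing [a i * e_i] gives a second factor [vec a]; its square [- norm2 a] cancels the
   denominator. *)
have -> : \big[Rplus/0]_(a <- Rp) \big[Rplus/0]_(i < d) (2 * k a / norm2 a * (a i *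
        coord b A (clmul (vec (unitv i)) (clmul (vec a) (f (refl a x)))))) =
    -2 * \big[Rplus/0]_(a <- Rp) (k a * coord b A (f (refl a x))).
  rewrite big_distrr /=; apply: eq_big_In => a /Rp_neq0 a0; rewrite -big_distrr /=.
  transitivity (2 * k a / norm2 a * coord b A (clmul (vec a) (clmul (vec a) (f (refl a x))))).
    congr (_ * _); rewrite (clmul_vec_sum a (clmul _ _)) coordE.
    by apply: eq_bigr => i _; rewrite coordE.
  by rewrite clmul_vec_sqr coordE; field.
have -> : \big[Rplus/0]_(a <- Rp) (k a * (coord b A (f x) - coord b A (f (refl a x)))) =
    gamma_k Rp k * coord b A (f x) - \big[Rplus/0]_(a <- Rp) (k a * coord b A (f (refl a x))).
  transitivity (\big[Rplus/0]_(a <- Rp)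
      (k a * coord b A (f x) + -1 * (k a * coord b A (f (refl a x))))).
    by apply: eq_bigr => a _; ring.
  by rewrite big_split -big_distrl -big_distrr /= -/(gamma_k Rp k); ring.
by rewrite /mu_k; ring.
Qed.

(** Homogeneity supplies the differentiability behind linearity. The degree varies with the term,
    since the iterates of [D_+] mix degrees. *)
Lemma dirac_sum (I : Type) (s : seq I) (c : I -> R) (F : I -> CFun d) (m : I -> nat) x :
  (forall l, homogeneous (m l) (F l)) ->
  dirac Rp k (fun y => \big[@ccl_add d/@ccl0 d]_(l <- s) ccl_scale (c l) (F l y)) x =
  \big[@ccl_add d/@ccl0 d]_(l <- s) ccl_scale (c l) (dirac Rp k (F l) x).
Proof.
move=> hF; rewrite /dirac.
under [RHS]eq_bigr do rewrite ccl_scale_big.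
rewrite exchange_big /=; apply: eq_bigr => i _.
transitivity (clmul (vec (unitv i))
    (\big[@ccl_add d/@ccl0 d]_(l <- s) ccl_scale (c l) (dunkl Rp k i (F l) x))); last first.
  by rewrite clmul_vec_big; apply: eq_bigr => l _; rewrite clmul_vecZ.
congr clmul; apply: coord_ext => b A; rewrite coord_dunkl coordE.
transitivity (\big[Rplus/0]_(l <- s) (c l * dunkl_scalar Rp k i (fun y => coord b A (F l y)) x)).
  rewrite -(dunkl_scalar_sum Rp k); last by move=> l _; case: (hF l b A).
  congr dunkl_scalar; apply: functional_extensionality => y; rewrite coordE.
  by apply: eq_bigr => l _; rewrite coordE.
by apply: eq_bigr => l _; rewrite coordE coord_dunkl.
Qed.

Lemma homogeneous_hom_poly n (P : CFun d) : is_hom_poly n P -> homogeneous n P.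
Proof.
move=> [c Pc] b A.
rewrite (_ : (fun x => _) = fun x : vecR d => \big[Rplus/0]_(e : {ffun 'I_d -> 'I_n.+1} |
     (\sum_(i < d) (e i : nat))%N == n)
   (coord b A (c e) * \big[Rmult/1]_(i < d) (x i ^ (e i : nat)))).
  (* Only the degree is rewritten as the sum of the exponents, since [n] also occurs in the type of
     [e]. *)
  by apply: euler_sum => e /eqP {1}<-; apply: euler_monomial.
apply: functional_extensionality => x; rewrite Pc coordE; apply: eq_bigr => e _.
by rewrite coordE; ring.
Qed.

(** * Clifford powers of the variable times a monogenic polynomial *)

Section Monogenic.
Variables (n : nat) (P : CFun d).
Hypotheses (hP : homogeneous n P) (DP : forall x, dirac Rp k P x = @ccl0 d).

Definition vec_pow (m : nat) : CFun d := fun x => iter m (clmul (vec x)) (P x).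

Lemma homogeneous_vec_pow m : homogeneous (n + m) (vec_pow m).
Proof.
elim: m => [|m IH]; first by rewrite addn0.
by rewrite addnS; apply: homogeneous_clmul_vec.
Qed.

(** If [- q_m] is the factor, the commutation rule gives [q_(m+1) = 2 (n + m + 1) + mu - q_m] with
    [q_0 = 2 n + mu]; the parity split solves this recurrence. *)
Lemma dirac_vec_powS m x :
  dirac Rp k (vec_pow m.+1) x =
  ccl_scale (- (if odd m then INR m.+1 else 2 * INR n + mu_k Rp k + INR m)) (vec_pow m x).
Proof.
elim: m => [|m IH].
  rewrite [LHS](dirac_clmul_vec x (homogeneous_vec_pow 0)) DP clmul_vec0.
  by apply: coord_ext => b A; rewrite !coordE plus_INR /=; ring.
rewrite [LHS](dirac_clmul_vec x (homogeneous_vec_pow m.+1)) IH clmul_vecZ.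
apply: coord_ext => b A; rewrite !coordE plus_INR !S_INR /=.
by case: (odd m) => /=; ring.
Qed.

Lemma vec_pow_even j x : vec_pow j.*2 x = ccl_scale ((- norm2 x) ^ j) (P x).
Proof.
elim: j => [|j IH]; first by apply: coord_ext => b A; rewrite coordE /=; ring.
rewrite doubleS /vec_pow !iterS -/(vec_pow j.*2 x) IH clmul_vec_sqr.
by apply: coord_ext => b A; rewrite !coordE /=; ring.
Qed.

Lemma vec_pow_odd j x :
  vec_pow j.*2.+1 x = ccl_scale ((- norm2 x) ^ j) (clmul (vec x) (P x)).
Proof. by rewrite /vec_pow iterS -/(vec_pow j.*2 x) vec_pow_even clmul_vecZ. Qed.

Lemma INR_double j : INR j.*2 = 2 * INR j.
Proof. by rewrite -mul2n mult_INR. Qed.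

Lemma dirac_vec_pow_odd j x :
  dirac Rp k (vec_pow j.*2.+1) x =
  ccl_scale (- (2 * INR n + mu_k Rp k + 2 * INR j)) (vec_pow j.*2 x).
Proof. by rewrite dirac_vec_powS odd_double INR_double. Qed.

Lemma dirac_vec_pow_even j x :
  dirac Rp k (vec_pow j.+1.*2) x = ccl_scale (- (2 * INR j.+1)) (vec_pow j.*2.+1 x).
Proof. by rewrite [LHS]dirac_vec_powS -doubleS INR_double oddS odd_double. Qed.

End Monogenic.
End DunklDirac.

(** * Iterating D_+ *)

Section Iteration.
Variables (d : nat) (Rp : seq (vecR d)) (k : vecR d -> R).
Hypothesis Rp_neq0 : forall a, In a Rp -> norm2 a <> 0.
Variables (n : nat) (P : CFun d).
Hypotheses (hP : homogeneous n P) (DP : forall x, dirac Rp k P x = @ccl0 d).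
(** Chosen so that the factor [2 n + mu + 2 j] of [dirac_vec_pow_odd] becomes [2 (j + al + 1)]. *)
Let al := mu_k Rp k / 2 + INR n - 1.
Hypothesis al_gt : 0 < al + 1.

Definition even_comb (c : nat -> R) (t : nat) : CFun d := fun y =>
  \big[@ccl_add d/@ccl0 d]_(j < t) ccl_scale (c j) (vec_pow P j.*2 y).
Definition odd_comb (c : nat -> R) (t : nat) : CFun d := fun y =>
  \big[@ccl_add d/@ccl0 d]_(j < t) ccl_scale (c j) (vec_pow P j.*2.+1 y).

(** The power [2 j + 1] receives [c j.+1] from the Dirac operator and [c j] from multiplication by
    [x]; at the top only the latter remains. *)
Lemma Dplus_even_comb (c c' : nat -> R) t :
  (forall j, (j < t)%N -> c' j = -2 * (INR j.+1 * c j.+1 + c j)) -> c' t = -2 * c t ->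
  Dplus Rp k (even_comb c t.+1) = odd_comb c' t.+1.
Proof.
move=> c'E c't; apply: functional_extensionality => y; rewrite /Dplus.
rewrite (dirac_sum Rp k _ _ y (fun j : 'I_t.+1 => homogeneous_vec_pow hP j.*2)).
apply: coord_ext => b A; rewrite !coordE clmul_vec_big coordE.
(* The Dirac sum loses its first term by monogenicity of [P], and the other sums give up their last
   one, which aligns the indices. *)
rewrite big_ord_recl DP [X in -2 * X]big_ord_recr [RHS]big_ord_recr /= c't.
rewrite !clmul_vecZ !coordE.
transitivity (\big[Rplus/0]_(j < t) (-2 * (INR j.+1 * c j.+1) * coord b A (vec_pow P j.*2.+1 y)) +
  -2 * (\big[Rplus/0]_(j < t) (c j * coord b A (vec_pow P j.*2.+1 y)) +
        c t * coord b A (vec_pow P t.*2.+1 y))).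
  congr (_ + _ * (_ + _)).
    rewrite Rmult_0_r Rplus_0_l; apply: eq_bigr => j _.
    rewrite /bump leq0n !add1n (dirac_vec_pow_even Rp_neq0 hP DP) !coord_scale; ring.
  by apply: eq_bigr => j _; rewrite clmul_vecZ coordE.
rewrite Rmult_plus_distr_l -Rplus_assoc big_distrr -big_split /=; congr (_ + _); last ring.
by apply: eq_bigr => j _; rewrite coordE c'E // -/(INR j.+1); ring.
Qed.

(** The bottom coefficient comes from the Dirac operator alone, the top one from multiplication
    alone, and the middle ones from both; hence one more term. *)
Lemma Dplus_odd_comb (c c' : nat -> R) t :
  (forall j, (j < t)%N -> c' j.+1 = -2 * ((INR j.+1 + al + 1) * c j.+1 + c j)) ->
  c' 0%N = -2 * ((al + 1) * c 0%N) -> c' t.+1 = -2 * c t ->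
  Dplus Rp k (odd_comb c t.+1) = even_comb c' t.+2.
Proof.
move=> c'E c'0 c't; apply: functional_extensionality => y; rewrite /Dplus.
rewrite (dirac_sum Rp k _ _ y (fun j : 'I_t.+1 => homogeneous_vec_pow hP j.*2.+1)).
apply: coord_ext => b A; rewrite !coordE clmul_vec_big coordE.
rewrite big_ord_recl [X in -2 * X]big_ord_recr [RHS]big_ord_recl [X in _ = _ + X]big_ord_recr /=.
have D j : coord b A (dirac Rp k (vec_pow P j.*2.+1) y) =
    -2 * (INR j + al + 1) * coord b A (vec_pow P j.*2 y).
  by rewrite (dirac_vec_pow_odd Rp_neq0 hP DP) coordE /al; field.
rewrite !clmul_vecZ !coord_scale /bump leq0n !add1n c't c'0.
transitivity (-2 * ((al + 1) * c 0%N) * coord b A (vec_pow P 0 y) +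
  \big[Rplus/0]_(j < t) (-2 * ((INR j.+1 + al + 1) * c j.+1) * coord b A (vec_pow P j.+1.*2 y)) +
  -2 * (\big[Rplus/0]_(j < t) (c j * coord b A (vec_pow P j.+1.*2 y)) +
        c t * coord b A (vec_pow P t.+1.*2 y))).
  congr (_ + _ + _ * (_ + _)); first by rewrite (D 0%N) /=; ring.
    by apply: eq_bigr => j _; rewrite /bump leq0n !add1n coordE D; ring.
  by apply: eq_bigr => j _; rewrite clmul_vecZ coordE.
rewrite Rmult_plus_distr_l -!Rplus_assoc big_distrr [X in X + _]Rplus_assoc -big_split /=.
congr (_ + _ + _); last by rewrite add0n; ring.
by apply: eq_bigr => j _; rewrite add0n add1n coordE c'E // -/(INR j.+1); ring.
Qed.

(** Even to odd is [laguerre_coef_raise], odd to even is [laguerre_coef_lower], whose factor [t + 1]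
    turns [t!] into [(t + 1)!]. Two sign changes restore the sign. *)
Lemma Hsmu_comb t :
  Hsmu Rp k t.*2 P =
    even_comb (fun j => 2 ^ t.*2 * INR (fact t) * laguerre_coef al t j) t.+1 /\
  Hsmu Rp k t.*2.+1 P =
    odd_comb (fun j => - 2 ^ t.*2.+1 * INR (fact t) * laguerre_coef (al + 1) t j) t.+1.
Proof.
(* This half-step serves both the induction and the odd half of the conclusion. *)
have even_odd u : Hsmu Rp k u.*2 P =
    even_comb (fun j => 2 ^ u.*2 * INR (fact u) * laguerre_coef al u j) u.+1 ->
    Hsmu Rp k u.*2.+1 P =
    odd_comb (fun j => - 2 ^ u.*2.+1 * INR (fact u) * laguerre_coef (al + 1) u j) u.+1.
  rewrite /Hsmu iterS => ->; apply: Dplus_even_comb => [j lt_ju|].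
    by rewrite -laguerre_coef_raise //=; ring.
  by rewrite !laguerre_coef_diag //=; [ring | lra].
suff even : Hsmu Rp k t.*2 P =
    even_comb (fun j => 2 ^ t.*2 * INR (fact t) * laguerre_coef al t j) t.+1.
  by split=> //; apply: even_odd.
elim: t => [|t /even_odd IH].
  apply: functional_extensionality => y; apply: coord_ext => b A.
  rewrite /even_comb big_ord_recl big_ord0 !coordE laguerre_coef_diag //= /vec_pow /=; field.
rewrite doubleS /Hsmu iterS -/(Hsmu Rp k t.*2.+1 P) IH; apply: Dplus_odd_comb => [j lt_jt||].
(* The factor [t + 1] is split off the factorial to expose the right-hand side of
   [laguerre_coef_lower]. *)
- rewrite (_ : 2 ^ t.*2.+2 * _ * _ =
      2 * 2 ^ t.*2.+1 * INR (fact t) * (INR t.+1 * laguerre_coef al t.+1 j.+1)).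
    by rewrite -laguerre_coef_lower //; ring.
  by rewrite INR_factS /=; ring.
- rewrite (_ : 2 ^ t.*2.+2 * _ * _ =
      2 * 2 ^ t.*2.+1 * INR (fact t) * (INR t.+1 * laguerre_coef al t.+1 0)).
    by rewrite -laguerre_coef_lower0 //; ring.
  by rewrite INR_factS /=; ring.
- rewrite !laguerre_coef_diag //; last lra.
  have := INR_fact_lt_0 t; have := INRS_gt0 t => m0 f0.
  by rewrite INR_factS -(tech_pow_Rmult _ t.*2.+1); field; lra.
Qed.

End Iteration.

Lemma ccl_scale_sum_laguerre d al (r : R) m (x : vecR d) (u : CCl d) :
  \big[@ccl_add d/@ccl0 d]_(j < m.+1)
     ccl_scale (r * laguerre_coef al m j) (ccl_scale ((- norm2 x) ^ j) u) =
  ccl_scale (r * laguerre al m (norm2 x)) u.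
Proof.
apply: coord_ext => b A; rewrite !coordE /laguerre big_distrr big_distrl /=.
by apply: eq_bigr => j _; rewrite !coordE /laguerre_coef; ring.
Qed.

Unset Implicit Arguments.

Theorem theorem3p3 (d : nat) (RS Rp : seq (vecR d)) (k : vecR d -> R)
  (n s : nat) (P : CFun d) :
  (2 <= d)%N ->
  root_system RS ->
  positive_subsystem RS Rp ->
  multiplicity RS k ->
  0 < gamma_k Rp k ->
  in_Mn Rp k n P ->
  forall x : vecR d,
    (~~ odd s ->
       Hsmu Rp k s P x =
       ccl_scale (2 ^ s * INR (fact s./2)
                  * laguerre (mu_k Rp k / 2 + INR n - 1) s./2 (norm2 x)) (P x)) /\
    (odd s ->
       Hsmu Rp k s P x =
       ccl_scale (- (2 ^ s) * INR (fact s./2)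
                  * laguerre (mu_k Rp k / 2 + INR n) s./2 (norm2 x))
                 (clmul (vec x) (P x))).
Proof.
move=> _ [_ [RS_neq0 _]] [_ [b [_ Rp_sub]]] _ gamma_gt0 [poly_P DP] x.
have Rp_neq0 a : In a Rp -> norm2 a <> 0.
  by move=> /Rp_sub[aR _]; apply: norm2_neq0; apply: RS_neq0.
(* The quantity equals [gamma_k Rp k + d / 2 + n]. *)
have al_gt : 0 < mu_k Rp k / 2 + INR n - 1 + 1.
  by rewrite /mu_k; have := pos_INR n; have := pos_INR d; lra.
have [even_s odd_s] := Hsmu_comb Rp_neq0 (homogeneous_hom_poly poly_P) DP al_gt s./2.
split=> s_parity.
  (* Only the iteration count and the exponent of 2 are rewritten; the occurrences of [s./2]
     stay. *)
  rewrite -{1 2}(odd_double_half s) (negbTE s_parity) add0n even_s -ccl_scale_sum_laguerre.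
  by apply: eq_bigr => j _; rewrite vec_pow_even.
(* The odd case has Laguerre parameter [al + 1]. *)
rewrite (_ : mu_k Rp k / 2 + INR n = mu_k Rp k / 2 + INR n - 1 + 1); last by ring.
rewrite -{1 2}(odd_double_half s) s_parity add1n odd_s -ccl_scale_sum_laguerre.
by apply: eq_bigr => j _; rewrite vec_pow_odd.
Qed.
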